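(* Let $\{G_n\}_{n\ge0}$ be a Gibonacci sequence and let $\{G'_n\}_{n\ge0}$ be the associated modified Gibonacci sequence. For all integers $n\geq 2$, $$G_1(G_n-G'_n)+G_0(G_{n-1}-G'_{n-1})=(G_1-G_0)G_{n-2}.$$
   Context: A Gibonacci sequence is a sequence satisfying $G_n=G_{n-1}+G_{n-2}$ for $n\ge2$, with initial values $G_0,G_1$ chosen freely (here arbitrary integers). The associated modified Gibonacci sequence is defined by $G'_0=G_1$, $G'_1=G_0$ and $G'_n=G'_{n-1}+G'_{n-2}$ for $n\ge 2$. *)

(* Defs.v *)
From mathcomp Require Import all_boot all_order all_algebra.
Set Implicit Arguments.
Unset Strict Implicit.
Unset Printing Implicit Defensive.
Import GRing.Theory.
Local Open Scope ring_scope.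

(* The initial values G 0 and G 1 are unconstrained. *)
Definition gibonacci (G : nat -> int) : Prop :=
  forall n : nat, (2 <= n)%N -> G n = G (n - 1)%N + G (n - 2)%N.

Definition modified_gibonacci (G G' : nat -> int) : Prop :=
  [/\ G' 0%N = G 1%N, G' 1%N = G 0%N & gibonacci G'].

(* Main.v *)
Require Import Defs.
From mathcomp Require Import all_boot all_order all_algebra.
From mathcomp Require Import ring.
Set Implicit Arguments.
Unset Strict Implicit.
Unset Printing Implicit Defensive.
Import GRing.Theory.
Local Open Scope ring_scope.

(** Write [a = G 0], [b = G 1] and [D = G - G'].  Both sides of the identity,
    read as functions of [m = n - 2], are fixed linear combinations of shifts
    of [G] and [G'], hence satisfy the Fibonacci recurrence; by
    [gibonacci_unique] it is enough to compare them at [m = 0] and [m = 1].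
    Since [D 1 = b - a], [D 2 = 0] and [D 3 = b - a], the left-hand side
    [b * D (m + 2) + a * D (m + 1)] takes the values [a * (b - a)] and
    [b * (b - a)] there, which are [(b - a) * G 0] and [(b - a) * G 1].
    Behind this lies [D (m + 2) = (b - a) * F m], with [F] the Fibonacci
    sequence, together with [G m = b * F m + a * F (m - 1)]. *)

Lemma gibonacciSS (G : nat -> int) :
  gibonacci G <-> forall m, G m.+2 = G m.+1 + G m.
Proof.
split=> [hG m | hG [|[|m]] // _]; first by rewrite hG // !subSS !subn0.
by rewrite !subSS !subn0 hG.
Qed.

Lemma gibonacci_unique (G H : nat -> int) :
  gibonacci G -> gibonacci H -> G 0%N = H 0%N -> G 1%N = H 1%N -> G =1 H.
Proof.
move=> /gibonacciSS hG /gibonacciSS hH h0 h1 m.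
(* The recurrence has order two, so the induction carries two terms. *)
suff [] : G m = H m /\ G m.+1 = H m.+1 by [].
by elim: m => [//|m [IH0 IH1]]; rewrite hG hH IH0 IH1.
Qed.

Theorem mainTheorem8 (G G' : nat -> int)
    (hG : gibonacci G) (hG' : modified_gibonacci G G')
    (n : nat) (hn : (2 <= n)%N) :
  G 1%N * (G n - G' n) + G 0%N * (G (n - 1)%N - G' (n - 1)%N)
    = (G 1%N - G 0%N) * G (n - 2)%N.
Proof.
case: hG' => h0 h1 /gibonacciSS rG'; move/gibonacciSS: hG => rG.
case: n hn => [|[|m]] // _; rewrite !subSS !subn0.
pose L k := G 1%N * (G k.+2 - G' k.+2) + G 0%N * (G k.+1 - G' k.+1).
pose R k := (G 1%N - G 0%N) * G k.
apply: (@gibonacci_unique L R).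
- by apply/gibonacciSS => k; rewrite /L !(rG k.+2) !(rG' k.+2) (rG k.+1) (rG' k.+1); ring.
- by apply/gibonacciSS => k; rewrite /R rG; ring.
- by rewrite /L /R !rG !rG' h0 h1; ring.
- by rewrite /L /R !rG !rG' h0 h1; ring.
Qed.
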